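(* Fix integers $k\geq 2$ and $n>r\geq 3$, and integers $s_0,\dots,s_{k-1}$ with $n\geq s_i\geq r+1$ for all $i$. If $n \nrightarrow (s_0,\dots,s_{k-1})^{r}$, then \[ 2^n \nrightarrow (s_0+1,\dots,s_{k-1}+1,\underbrace{r+2,\dots,r+2}_{\eta(r)\text{ terms}})^{r+1}, \] where $\eta(r)=1$ if $r=3$, $\eta(r)=2$ if $r>3$ is even, and $\eta(r)=3$ if $r>3$ is odd. That is, there is a colouring of the $(r+1)$-subsets of $\{0,\dots,2^n-1\}$ with $k+\eta(r)$ colours such that for each $i<k$ no set of size $s_i+1$ is monochromatic in colour $i$, and no set of size $r+2$ is monochromatic in any of the colours $k,\dots,k+\eta(r)-1$.
   Context: For $m\in\mathbb N$ write $[m]=\{0,\dots,m-1\}$ and $\binom{S}{r}$ for the set of $r$-element subsets of $S$. Given $k\geq 2$, $n>r\geq1$, an $r$-subset $k$-colouring of $[n]$ is a function $f:\binom{[n]}{r}\to[k]$; a set $X\subset[n]$ is monochromatic in colour $i$ if $f(T)=i$ for all $T\in\binom{X}{r}$. For integers $s_0,\dots,s_{k-1}$ with $n\geq s_i>r$, the relation $n\to(s_0,\dots,s_{k-1})^r$ means that for every $f:\binom{[n]}{r}\to[k]$ there is a colour $i$ and a subset of $[n]$ of size $s_i$ monochromatic in colour $i$; $n\nrightarrow(\dots)^r$ is its negation. $(s)_k^r$ abbreviates $(s,\dots,s)^r$ with $k$ entries. *)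

(* Defs.v *)
From mathcomp Require Import all_boot.
Set Implicit Arguments. Unset Strict Implicit. Unset Printing Implicit Defensive.

(* An r-subset k-colouring of [n] is modelled as a function from the subsets
   of 'I_n to 'I_k; only its values on r-element subsets are ever used. *)
Definition monochromatic (n r k : nat) (f : {set 'I_n} -> 'I_k)
  (X : {set 'I_n}) (i : 'I_k) : Prop :=
  forall T : {set 'I_n}, T \subset X -> #|T| = r -> f T = i.

Definition arrows (n : nat) (s : seq nat) (r : nat) : Prop :=
  forall f : {set 'I_n} -> 'I_(size s),
    exists (i : 'I_(size s)) (X : {set 'I_n}),
      #|X| = nth 0 s i /\ monochromatic r f X i.

Definition eta (r : nat) : nat :=
  if r == 3 then 1 else if ~~ odd r then 2 else 3.

(* Main.v *)
Require Import Defs.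
From mathcomp Require Import all_boot.
From mathcomp Require Import zify.

(** Write delta(x, y) for the highest bit in which x and y differ and attach to
    a set x_0 < ... < x_m the sequence u of the delta(x_i, x_{i+1}). Adjacent
    entries of u differ, and deleting a vertex deletes from u an entry that is
    not an interior local maximum (a peak); every such entry can be deleted.

    If u has no peak, it decreases and then increases, its entries are distinct
    and every subsequence of u comes from a subset. So (r+1)-sets without peak
    can be coloured by f applied to the set of their deltas. An (r+1)-set with a
    peak is coloured by a code in {0, 1, 2} of its word of peak flags. The two
    windows of an (r+2)-set obtained by removing an end vertex receive different
    codes, unless one of them has no peak or the word is 100..., in which case
    deleting one of these zeros changes the code. One code suffices if r = 3, as a
    word of length 2 has a window without peak. If r is even, code 2 never
    occurs next to a window without peak and can share an old colour. *)

(** * Highest differing bits *)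

(* The position of the highest binary digit in which x < y differ: it is the
   largest 2-adic valuation of an integer in the interval ]x, y]. *)
Definition delta (x y : nat) : nat := \max_(x.+1 <= v < y.+1) logn 2 v.

Lemma delta_max x y z : x <= y -> y <= z ->
  delta x z = maxn (delta x y) (delta y z).
Proof. by move=> xy yz; rewrite /delta (@big_cat_nat _ _ _ y.+1). Qed.

Lemma logn_le_delta x y v : x < v <= y -> logn 2 v <= delta x y.
Proof.
by move=> h; apply: leq_bigmax_seq => //; rewrite mem_index_iota.
Qed.

Lemma delta_attained x y : x < y -> exists2 v, x < v <= y & logn 2 v = delta x y.
Proof.
elim: y => // y IH; rewrite ltnS leq_eqVlt => /orP[/eqP->|xy].
  by exists y.+1; rewrite ?ltnSn ?leqnn // /delta big_nat1.
have [v /andP[xv vy] ev] := IH xy.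
have e1 : delta y y.+1 = logn 2 y.+1 by rewrite /delta big_nat1.
rewrite (@delta_max x y y.+1) ?(ltnW xy) // e1.
case: (leqP (logn 2 y.+1) (delta x y)) => _; last first.
  by exists y.+1; rewrite ?leqnn ?ltnS ?(ltnW xy).
by exists v; rewrite ?xv ?leqW.
Qed.

(* Two numbers with the same 2-adic valuation have one of larger valuation
   between them. *)
Lemma delta_neq x y z : x < y -> y < z -> delta x y != delta y z.
Proof.
move=> xy yz; apply/eqP => E.
have [v /andP[xv vy] ev] := delta_attained _ _ xy.
have [w /andP[yw wz] ew] := delta_attained _ _ yz.
move: ew; rewrite -E => ew.
set d := delta x y in ev ew E.
have v0 : 0 < v by lia.
have w0 : 0 < w by lia.
have [a aodd va] := pfactor_coprime (isT : prime 2) v0.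
have [b bodd wb] := pfactor_coprime (isT : prime 2) w0.
rewrite ev in va; rewrite ew in wb.
rewrite coprime2n in aodd; rewrite coprime2n in bodd.
have p0 : 0 < 2 ^ d by rewrite expn_gt0.
(* [v] and [w] are odd multiples of [2 ^ d]; the even multiple [a.+1 * 2 ^ d] between them lies in
   one of the two intervals and has too large a valuation. *)
have ab : a < b by rewrite -(ltn_pmul2r p0) -va -wb; lia.
have ab1 : a.+1 < b.
  by rewrite ltn_neqAle ab andbT; apply/eqP => e; move: bodd; rewrite -e /= aodd.
have lt1 : v < a.+1 * 2 ^ d by rewrite va ltn_pmul2r.
have lt2 : a.+1 * 2 ^ d < w by rewrite wb ltn_pmul2r.
have big : d < logn 2 (a.+1 * 2 ^ d).
  rewrite -pfactor_dvdn //; last lia.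
  by rewrite expnS dvdn_mul // dvdn2 /= aodd.
case: (leqP (a.+1 * 2 ^ d) y) => h.
  have := @logn_le_delta x y (a.+1 * 2 ^ d); rewrite -/d; lia.
have := @logn_le_delta y z (a.+1 * 2 ^ d); rewrite -E; lia.
Qed.

Lemma delta_lt n x y : x < y -> y < 2 ^ n -> delta x y < n.
Proof.
move=> xy yn; have [v /andP[xv vy] <-] := delta_attained _ _ xy.
rewrite -(ltn_exp2l _ _ (isT : 1 < 2)); apply: leq_ltn_trans yn.
apply: leq_trans vy; apply: dvdn_leq; first lia.
exact: pfactor_dvdnn.
Qed.

(** * Delta words of subsets and deletion of entries *)

Definition deltas (X : seq nat) : seq nat :=
  if X is x :: l then pairmap delta x l else [::].

(** Subsets are subsequences of the increasing list of vertices; a word of length [m] comes from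
    [m + 1] vertices. *)
Definition realized (X u : seq nat) : Prop :=
  exists x l, subseq (x :: l) X /\ u = pairmap delta x l.

Section Realized.
Variable X : seq nat.
Hypothesis Xs : sorted ltn X.

Lemma realized_sorted x l : subseq (x :: l) X -> path ltn x l.
Proof. by move=> h; exact: (subseq_sorted ltn_trans h Xs). Qed.

Lemma realized_adjacent u1 a b u2 : realized X (u1 ++ [:: a, b & u2]) -> a != b.
Proof.
move=> [x [l [/realized_sorted pl]]].
elim: u1 x l pl => [|e u1 IH] x [|y l] //=.
  case: l => //= z l /and3P[xy yz _] [-> -> _]; exact: delta_neq.
by move=> /andP[_ pl] [_ /IH]; apply.
Qed.

(* Removing a vertex merges the two entries next to it into their maximum, so
   every entry that is not an interior local maximum can be deleted. *)
Lemma realized_delete u1 d u2 : realized X (u1 ++ d :: u2) ->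
  [|| u1 == [::], u2 == [::], d < last 0 u1 | d < head 0 u2] ->
  realized X (u1 ++ u2).
Proof.
move=> [x [l [sl e]]]; have pl := realized_sorted _ _ sl.
have sz : size l = (size u1 + size u2).+1.
  by rewrite -(size_pairmap delta x l) -e size_cat /= addnS.
have [l1 [y [l2 [el s1]]]] : exists l1 y l2, l = l1 ++ y :: l2 /\ size l1 = size u1.
  exists (take (size u1) l), (nth 0 l (size u1)), (drop (size u1).+1 l).
  by rewrite -drop_nth ?cat_take_drop ?size_takel // sz; lia.
rewrite {}el in sz sl e pl *.
move: e; rewrite pairmap_cat => /eqP; rewrite eqseq_cat ?size_pairmap //=.
case/andP=> /eqP e1 /eqP[e2 e3].
move: pl; rewrite cat_path /= => /and3P[pl1 py pl2].
case/or4P=> [/eqP u1E|/eqP u2E|h|h].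
- exists y, l2; split; last by rewrite u1E e3.
  apply: subseq_trans sl; rewrite -cat_cons; exact: suffix_subseq.
- exists x, l1; split; last by rewrite u2E cats0.
  apply: subseq_trans sl; rewrite -cat_cons; exact: prefix_subseq.
(* The preceding entry is larger: the vertex [z] between it and [d] is removed. The default 0
   excludes an empty [u1]. *)
- case/lastP: l1 s1 e1 sl e2 pl1 py {sz} => [|l1 z] s1 e1 sl e2 pl1 py.
    by rewrite e1 in h.
  rewrite last_rcons in e2 py.
  move: pl1; rewrite rcons_path => /andP[pl1 pz].
  have ed : delta (last x l1) y = delta (last x l1) z.
    rewrite (@delta_max _ z) ?(ltnW pz) ?(ltnW py) //; apply/maxn_idPl.
    by move: h; rewrite e1 e2 -cats1 pairmap_cat /= last_cat /= => /ltnW.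
  exists x, (l1 ++ y :: l2); split.
    apply: subseq_trans sl; rewrite -!cat_cons -rcons_cons cat_rcons.
    by apply: cat_subseq => //; exact: subseq_cons.
  by rewrite e1 e3 pairmap_cat -cats1 pairmap_cat /= -catA /= ed.
(* The following entry is larger: here [y] itself is removed. *)
- case: l2 e3 sl pl2 sz => [|z l2] e3 sl pl2 sz; first by rewrite e3 in h.
  case/andP: pl2 => yz pl2; rewrite e3 /= in h.
  have ed : delta (last x l1) z = delta y z.
    rewrite (@delta_max _ y) ?(ltnW py) ?(ltnW yz) //; apply/maxn_idPr.
    by rewrite -e2 ltnW.
  exists x, (l1 ++ z :: l2); split.
    apply: subseq_trans sl; rewrite -!cat_cons.
    by apply: cat_subseq => //; exact: subseq_cons.
  by rewrite e1 e3 pairmap_cat /= ed.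
Qed.

Lemma realized_behead a u : realized X (a :: u) -> realized X u.
Proof. by move=> h; apply: (realized_delete [::] a). Qed.

Lemma realized_belast u a : realized X (rcons u a) -> realized X u.
Proof.
rewrite -cats1 => h; rewrite -(cats0 u); apply: realized_delete h _.
by rewrite orbT.
Qed.

End Realized.

(** * Peak flags *)

Fixpoint peaks (u : seq nat) : bitseq :=
  match u with
  | a :: ((b :: c :: _) as u') => ((a < b) && (c < b)) :: peaks u'
  | _ => [::]
  end.

Lemma peaks_cons3 a b c u :
  peaks [:: a, b, c & u] = ((a < b) && (c < b)) :: peaks [:: b, c & u].
Proof. by []. Qed.

Lemma size_peaks u : size (peaks u) = size u - 2.
Proof.
elim: u => // a [|b [|c u]] //= IH; rewrite IH; lia.
Qed.

Lemma peaks_behead a u : 1 < size u -> behead (peaks (a :: u)) = peaks u.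
Proof. by case: u => [|b [|c u]]. Qed.

Lemma peaks_rcons u z : 1 < size u ->
  exists b, peaks (rcons u z) = rcons (peaks u) b.
Proof.
elim: u => // a [|b [|c u]] // IH _; first by exists ((a < b) && (z < b)).
have [//|d] := IH; rewrite !rcons_cons peaks_cons3 => ->.
by exists d.
Qed.

(** Of two adjacent entries only the larger can be a peak. *)
Lemma peaks_sorted u : sorted (fun x y => ~~ (x && y)) (peaks u).
Proof.
elim: u => // a [|b [|c [|d u]]] // IH.
rewrite !peaks_cons3 /= in IH *; rewrite IH andbT.
by lia.
Qed.

(** * Codes of flag words *)

(* On a word with [i] zeros before the first one and [j] zeros after the last
   one: 0 if [i] is odd, 1 if [j] is odd; when both are even, 1 if [i = j = 0]
   and an odd number of zeros separates the first two ones, and 2 otherwise. *)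
Definition code (w : bitseq) : nat :=
  if odd (find id w) then 0
  else if odd (find id (rev w)) ||
    [&& head false w, last false w & odd (find id (behead w))] then 1 else 2.

Lemma code_le2 w : code w <= 2.
Proof. by rewrite /code; case: ifP => // _; case: ifP. Qed.

Lemma code_eq0 w : (code w == 0) = odd (find id w).
Proof. by rewrite /code; case: ifP => // _; case: ifP. Qed.

(* The only collision between the two windows of a word is removed by deleting
   a zero between its first two ones. *)
Lemma code_windows w b :
  sorted (fun x y => ~~ (x && y)) (rcons w b) ->
  has id w -> has id (behead (rcons w b)) ->
  code (behead (rcons w b)) = code w ->
  exists t, [/\ rcons w b = [:: true, false, false & t], code w = 2
              & code [:: true, false & t] = 1].
Proof.
(* After a leading zero, the leading runs of the two windows have opposite parity, so exactly one
   window has code 0. *)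
case: w => [//|[] t] /=; last first.
  move=> _ ht _ E; move: (code_eq0 (rcons t b)); rewrite E code_eq0 /=.
  by rewrite -cats1 find_cat ht; case: (odd _).
move=> st _ hv E.
have ov : ~~ odd (find id (rcons t b)).
  by rewrite -code_eq0 E code_eq0.
case: t => [|[] t] // in st hv E ov *.
  by clear E ov; case: b st hv => /=; rewrite ?andbF.
case: t => [|[] t] // in st hv E ov *; first by clear E; case: b st hv ov.
(* The word now starts with 100. If its last letter is a one, the second window has code 2. *)
case: b ov hv {st} E => /= ov hv E.
  exists (rcons t true); split=> //.
    by rewrite -E /code -!rcons_cons rev_rcons /= (negbTE ov).
  rewrite /code -!rcons_cons rev_rcons last_rcons /=.
  by move: ov; rewrite /= !negbK => /negbTE->.
(* If the last letter is a zero, the trailing runs of the windows differ by one in length, so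
   exactly one window has code 1. *)
have ht : has id t by move: hv; rewrite -cats1 has_cat /= !orbF.
move: ov; rewrite -cats1 find_cat ht /= !negbK => ov.
have hr : has id (rev [:: false, false & t]) by rewrite has_rev.
move: E; rewrite /code -!rcons_cons rev_rcons [rev (true :: _)]rev_cons.
rewrite -[rcons (rev _) true]cats1 find_cat hr -[rcons _ false]cats1 find_cat.
rewrite /= ht /= !negbK (negbTE ov) andbF !orbF.
by case: (odd _).
Qed.

Lemma has_windows w b : 0 < size w -> has id (rcons w b) ->
  has id w || has id (behead (rcons w b)).
Proof. by case: w => // -[] w //= _ ->; rewrite orbT. Qed.

(** The word is 0...01, and its second window starts with an odd number of zeros. *)
Lemma code_window_last w b : 0 < size w -> ~~ odd (size w) ->
  ~~ has id w -> has id (rcons w b) -> code (behead (rcons w b)) = 0.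
Proof.
case: w => // -[] w //= _; rewrite negbK => ow hw.
rewrite -cats1 has_cat (negbTE hw) /= orbF => ->.
by apply/eqP; rewrite code_eq0 find_cat (negbTE hw) /= addn0.
Qed.

(** The word is 10...0, and its first window ends in an odd number of zeros. *)
Lemma code_window_first w b : 0 < size w -> ~~ odd (size w) ->
  has id (rcons w b) -> ~~ has id (behead (rcons w b)) -> code w = 1.
Proof.
case: w => // -[] w //= _; last by move=> _ ->.
rewrite negbK => ow _; rewrite -cats1 has_cat negb_or => /andP[hw _].
by rewrite /code /= rev_cons -cats1 find_cat has_rev (negbTE hw) /= size_rev addn0 ow.
Qed.

(* The larger of the two entries after the first peak is deleted. *)
Lemma peaks_delete u t :
  (forall u1 a b u2, u = u1 ++ [:: a, b & u2] -> a != b) ->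
  peaks u = [:: true, false, false & t] ->
  exists u1 d u2, [/\ u = u1 ++ d :: u2, (d < last 0 u1) || (d < head 0 u2)
    & peaks (u1 ++ u2) = [:: true, false & t]].
Proof.
case: u => [|a [|b [|c [|d [|e u]]]]] adj; try by case.
rewrite !peaks_cons3 => -[/andP[ab cb] /negbT nc /negbT nd et].
have cd := adj [:: a; b] c d (e :: u) erefl.
have de := adj [:: a; b; c] d e u erefl.
case: (ltngtP c d) cd => // [cd|dc] _.
  (* [d] is not a peak and differs from [e], so it is below [e] and can be deleted. *)
  have de' : d < e by lia.
  exists [:: a; b; c], d, (e :: u); split; rewrite /= ?cd ?de' ?orbT //.
  rewrite ab cb /= -et; congr [:: _, _ & _]; first by lia.
  case: u {adj et} => //= f u; congr (_ :: _); lia.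
exists [:: a; b], c, [:: d, e & u]; split; rewrite /= ?cb //.
rewrite -et /= ab (ltn_trans dc cb) /=; congr [:: _, _ & _]; lia.
Qed.

(** * Valleys *)

(** Triples need not be adjacent, so the property passes to subsequences. *)
Definition valley (u : seq nat) : Prop :=
  forall a b c, subseq [:: a; b; c] u -> a < b -> c < b -> False.

Lemma valley_sub u v : subseq v u -> valley u -> valley v.
Proof. by move=> vu H a b c h; apply: H; apply: subseq_trans vu. Qed.

Lemma valley_adjacent u1 a b c u2 : valley (u1 ++ [:: a, b, c & u2]) ->
  ~~ ((a < b) && (c < b)).
Proof.
move=> H; apply/negP => /andP[ab cb]; apply: (H a b c) => //.
apply: (subseq_trans _ (suffix_subseq _ _)).
by rewrite /= !eqxx sub0seq.
Qed.

Lemma valley_peaks u : valley u -> ~~ has id (peaks u).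
Proof.
elim: u => // a [|b [|c u]] // IH H; rewrite peaks_cons3 /= negb_or.
rewrite (valley_adjacent [::] _ _ _ _ H) IH //.
by apply: valley_sub H; exact: subseq_cons.
Qed.

Lemma subseq_cons2 (x y : nat) s t :
  subseq (x :: s) (y :: t) -> (x = y /\ subseq s t) \/ subseq (x :: s) t.
Proof. by rewrite /=; case: eqP => [->|_] h; [left | right]. Qed.

Lemma no_peaks_behead a u : ~~ has id (peaks (a :: u)) -> ~~ has id (peaks u).
Proof. by case: u => [|b [|c u]] //; rewrite peaks_cons3 /= negb_or => /andP[]. Qed.

(** Since adjacent entries differ, a word without peak increases from its first ascent on. *)
Lemma no_peaks_valley u : sorted (fun x y => x != y) u ->
  ~~ has id (peaks u) -> valley u.
Proof.
elim: u => [|a u IH]; first by move=> _ _ a b c.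
case: u IH => [|b u] IH; first by move=> _ _ x y z /=; case: (x == a).
move=> /andP[ab su] np x y z /subseq_cons2[[-> h] ay zy|h]; last first.
  by apply: IH h => //; exact: no_peaks_behead np.
have nb : valley (b :: u).
  by apply: IH => //; exact: no_peaks_behead np.
case: (leqP b a) => [ba|ba].
  move: (h) => /subseq_cons2[[yb _]|h']; first by lia.
  apply: (nb b y z) => //; last by lia.
  by rewrite /= eqxx.
have incr : forall c v, sorted (fun x y => x != y) [:: a, c & v] -> a < c ->
    ~~ has id (peaks [:: a, c & v]) -> path ltn c v.
  move=> c v; elim: v a c {ab np ay ba h} => //= d v IHv a' c /and3P[_ cd sv] ac.
  rewrite negb_or => /andP[n1 n2].
  have lcd : c < d by lia.
  by rewrite lcd /=; apply: (IHv c) => //=; rewrite cd.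
have pl : path ltn b u by apply: incr => //=; rewrite ab.
have : sorted ltn [:: y; z] := subseq_sorted ltn_trans h pl.
by rewrite /= andbT; lia.
Qed.

Section Valley.
Variable X : seq nat.
Hypothesis Xs : sorted ltn X.

Lemma realized_neq u : realized X u -> sorted (fun x y => x != y) u.
Proof.
move=> H; have {H} : exists u1, realized X (u1 ++ u) by exists [::].
elim: u => // a [|b u] // IH [u1 H]; rewrite /=.
rewrite (realized_adjacent _ Xs _ _ _ _ H); apply: IH.
by exists (rcons u1 a); rewrite cat_rcons.
Qed.

Lemma realized_valley u : realized X u -> ~~ has id (peaks u) -> valley u.
Proof. by move/realized_neq; exact: no_peaks_valley. Qed.

(** Each entry of a valley is first, last or below a neighbour, so unwanted entries can be deleted
    one by one from left to right. *)
Lemma valley_filter (p : pred nat) u1 u2 : realized X (u1 ++ u2) ->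
  valley (u1 ++ u2) -> realized X (u1 ++ filter p u2).
Proof.
elim: u2 u1 => // d u2 IH u1 H V /=; case: ifP => _.
  by rewrite -cat_rcons; apply: IH; rewrite cat_rcons.
apply: IH; last first.
  by apply: valley_sub V; apply: cat_subseq => //; exact: subseq_cons.
apply: (realized_delete _ Xs _ _ _ H).
case/lastP: u1 H V => //= u1 a; case: u2 => // [|c u2]; first by rewrite orbT.
rewrite cat_rcons => H V; rewrite last_rcons /=.
have ad := realized_adjacent _ Xs _ _ _ _ H.
rewrite -cat_rcons in H; have dc := realized_adjacent _ Xs _ _ _ _ H.
by have := valley_adjacent _ _ _ _ _ V; lia.
Qed.

(* Between two equal entries of a valley everything is smaller and can be
   deleted, which would make the two entries adjacent. *)
Lemma valley_uniq u : realized X u -> valley u -> uniq u.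
Proof.
have dup d v : forall u1 u2, realized X (u1 ++ d :: v ++ d :: u2) ->
    valley (u1 ++ d :: v ++ d :: u2) -> False.
  elim: v => [|e v IH] u1 u2 H V.
    by have := realized_adjacent _ Xs _ _ _ _ H; rewrite eqxx.
  have de := realized_adjacent _ Xs _ _ _ _ H.
  have ed : e < d.
    rewrite ltn_neqAle eq_sym de leqNgt; apply/negP => lde.
    apply: (V d e d) => //; apply: (subseq_trans _ (suffix_subseq _ _)).
    by rewrite /= !eqxx -cat1s; apply: subseq_trans (suffix_subseq _ _); rewrite /= eqxx sub0seq.
  apply: (IH u1 u2).
    rewrite -cat_rcons; apply: (realized_delete _ Xs _ e).
      by rewrite cat_rcons.
    by rewrite last_rcons ed !orbT.
  by apply: valley_sub V; apply: cat_subseq => //=; rewrite eqxx; exact: subseq_cons.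
move=> H V; have {H V} : exists u1, realized X (u1 ++ u) /\ valley (u1 ++ u).
  by exists [::].
elim: u => //= a u IH [u1 [H V]]; apply/andP; split.
  apply/negP => /splitPr uE; case: uE H V => v u2; exact: dup.
by apply: IH; exists (rcons u1 a); rewrite cat_rcons.
Qed.

(** * Windows of longer words *)

Lemma realized_windows r u : 1 < r -> size u = r.+1 -> realized X u ->
  exists v1 v2 b, [/\ realized X v1 /\ size v1 = r, realized X v2 /\ size v2 = r,
    peaks u = rcons (peaks v1) b & peaks v2 = behead (peaks u)].
Proof.
case/lastP: u => // v1 z r1; rewrite size_rcons => -[s1] H.
case E : (rcons v1 z) => [|a v2]; first by case: v1 s1 H E.
have s2 : size v2 = r by move: (congr1 size E); rewrite size_rcons /= s1 => -[].
have [b Eb] := peaks_rcons v1 z (eq_ind_r (fun k => 1 < k) r1 s1).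
exists v1, v2, b; split=> //.
- by split=> //; exact: realized_belast H.
- by split=> //; rewrite E in H; exact: realized_behead H.
- by rewrite -E.
- by rewrite peaks_behead ?s2.
Qed.

Lemma no_peaks_windows v1 v2 u b : 2 < size v1 -> peaks u = rcons (peaks v1) b ->
  peaks v2 = behead (peaks u) -> ~~ has id (peaks v1) -> ~~ has id (peaks v2) ->
  ~~ has id (peaks u).
Proof.
move=> s1 e1 -> n1; apply: contra => h; rewrite e1 in h *.
have := has_windows (peaks v1) b; rewrite (negbTE n1) /= size_peaks; apply=> //; lia.
Qed.

(** Induction on the length: each flag of a longer word belongs to one of its two windows. *)
Lemma no_peaks_extend r u : 2 < r -> r <= size u ->
  (forall v, realized X v -> size v = r -> ~~ has id (peaks v)) ->
  realized X u -> ~~ has id (peaks u).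
Proof.
move=> r2 + H; elim: {u}(size u) {-2}u (erefl (size u)) => [|m IH] u Eu ru Hu.
  by rewrite Eu in ru; lia.
case: (ltngtP r m.+1) => [rm|mr|rm]; [|lia|by apply: H; rewrite ?Eu].
have small v : realized X v -> size v = m -> ~~ has id (peaks v).
  by move=> Hv sv; apply: IH; rewrite ?sv.
have m1 : 1 < m by lia.
have [v1 [v2 [b [[H1 s1] [H2 s2] e1 e2]]]] := realized_windows _ _ m1 Eu Hu.
by apply: (no_peaks_windows v1 v2 u b) => //; [lia|apply: small..].
Qed.

(** If both windows had a peak, equal codes would force the word 100..., where a deletion turns code
    2 into code 1. *)
Lemma same_code_no_peaks r u : 2 < r -> size u = r.+1 -> realized X u ->
  (forall v v', realized X v -> realized X v' -> size v = r -> size v' = r ->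
     has id (peaks v) -> has id (peaks v') -> code (peaks v) = code (peaks v')) ->
  exists v1 v2 b, [/\ realized X v1 /\ size v1 = r, realized X v2 /\ size v2 = r,
    peaks u = rcons (peaks v1) b, peaks v2 = behead (peaks u) &
    ~~ (has id (peaks v1) && has id (peaks v2))].
Proof.
move=> r2 su Hu Hc.
have r1 : 1 < r by lia.
have [v1 [v2 [b [[H1 s1] [H2 s2] e1 e2]]]] := realized_windows _ _ r1 su Hu.
exists v1, v2, b; split=> //; apply/negP => /andP[h1 h2].
have so := peaks_sorted u; rewrite e1 in so.
have [//|//||t [et c2 c1]] := code_windows _ _ so.
- by rewrite -e1 -e2.
- by rewrite -e1 -e2; apply: Hc.
have adj l a c l' : u = l ++ [:: a, c & l'] -> a != c.
  by move=> eu; rewrite eu in Hu; exact: realized_adjacent Hu.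
have [l1 [d [l2 [eu dl pe]]]] := peaks_delete _ _ adj (etrans e1 et).
have Hv : realized X (l1 ++ l2).
  rewrite eu in Hu; apply: realized_delete Hu _ => //.
  by case/orP: dl => ->; rewrite ?orbT.
have sv : size (l1 ++ l2) = r by move: su; rewrite eu !size_cat /= addnS => -[].
by have := Hc _ _ Hv H1 sv s1; rewrite pe c1 c2 => /(_ isT h1).
Qed.

(** One window has no peak; if [u] had one, the other window would have code 0 or 1, as flag words
    of windows have even length. *)
Lemma even_no_peaks r u : 2 < r -> ~~ odd r -> size u = r.+1 -> realized X u ->
  (forall v, realized X v -> size v = r -> has id (peaks v) ->
     code (peaks v) = 2) -> ~~ has id (peaks u).
Proof.
move=> r2 ro su Hu Hc.
have [|v1 [v2 [b [[H1 s1] [H2 s2] e1 e2]]]] := same_code_no_peaks _ _ r2 su Hu.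
  by move=> v v' H H' sv sv' h h'; rewrite !Hc.
have c1 := Hc _ H1 s1; have c2 := Hc _ H2 s2.
have pw : 0 < size (peaks v1) by rewrite size_peaks; lia.
have ow : ~~ odd (size (peaks v1)) by rewrite size_peaks; lia.
rewrite negb_and => h12; apply/negP => hu; rewrite e1 in hu e2.
have := has_windows _ _ pw hu; rewrite -e2.
case/orP: h12 => h; rewrite (negbTE h) ?orbF /= => h'.
  by have := c2 h'; rewrite e2 (code_window_last _ _ pw ow).
by have := c1 h'; rewrite (code_window_first _ _ pw ow hu) // -e2.
Qed.

End Valley.

(** * From sets of ordinals to words *)

Definition vals n (Y : {set 'I_n}) : seq nat := [seq val i | i <- enum Y].

Lemma size_vals n (Y : {set 'I_n}) : size (vals n Y) = #|Y|.
Proof. by rewrite size_map -cardE. Qed.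

Lemma mem_vals n (Y : {set 'I_n}) (i : 'I_n) : (val i \in vals n Y) = (i \in Y).
Proof. by rewrite mem_map ?mem_enum //; exact: val_inj. Qed.

Lemma vals_sorted n (Y : {set 'I_n}) : sorted ltn (vals n Y).
Proof.
apply: (subseq_sorted ltn_trans _ (iota_ltn_sorted 0 n)).
rewrite -val_enum_ord; apply: map_subseq.
by rewrite [enum Y]/enum_mem [enum 'I_n]enumT; exact: filter_subseq.
Qed.

Lemma vals_lt n (Y : {set 'I_n}) v : v \in vals n Y -> v < n.
Proof. by case/mapP=> i _ ->; exact: ltn_ord. Qed.

Lemma subseq_vals n (X : {set 'I_n}) ys : subseq ys (vals n X) ->
  exists2 Y : {set 'I_n}, Y \subset X & vals n Y = ys.
Proof.
move=> sub; have inX := mem_subseq sub.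
exists [set i | val i \in ys].
  by apply/subsetP => i; rewrite inE => /inX; rewrite mem_vals.
apply: (irr_sorted_eq ltn_trans ltnn (vals_sorted _ _)).
  exact: (subseq_sorted ltn_trans sub (vals_sorted _ _)).
move=> v; apply/idP/idP => [|vy].
  by case/mapP=> i; rewrite mem_enum inE => h ->.
have vn := vals_lt _ _ _ (inX _ vy).
by rewrite -[v]/(val (Ordinal vn)) mem_vals inE.
Qed.

Lemma card_mem_ord n (u : seq nat) : uniq u -> all (fun d => d < n) u ->
  #|[set i : 'I_n | val i \in u]| = size u.
Proof.
move=> uu /allP un; rewrite -size_vals; apply/perm_size/uniq_perm => //.
  by rewrite map_inj_uniq ?enum_uniq //; exact: val_inj.
move=> v; apply/idP/idP => [|vu]; first by case/mapP=> i; rewrite mem_enum inE => h ->.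
by rewrite -[v]/(val (Ordinal (un _ vu))) mem_vals inE.
Qed.

Lemma realized_lt n (X : {set 'I_(2 ^ n)}) u : realized (vals _ X) u ->
  all (fun d => d < n) u.
Proof.
case=> x [l [sl ->]]; have pl := realized_sorted _ (vals_sorted _ _) _ _ sl.
have: all (fun v => v < 2 ^ n) l.
  by apply/allP => v vl; apply: (vals_lt _ X); apply: (mem_subseq sl); rewrite inE vl orbT.
elim: l x pl {sl} => //= y l IH x /andP[xy pl] /andP[yn ln].
by rewrite delta_lt //= IH.
Qed.

Lemma realized_set n r (X : {set 'I_n}) v : realized (vals _ X) v -> size v = r ->
  exists Y : {set 'I_n}, [/\ Y \subset X, #|Y| = r.+1 & deltas (vals n Y) = v].
Proof.
case=> x [l [sl ->]]; rewrite size_pairmap => sr.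
have [Y YX eY] := subseq_vals _ _ _ sl.
by exists Y; rewrite -size_vals eY /= sr.
Qed.

(** * The stepped-up colouring *)

(* For even r the code 2 is given the old colour 0: every (r+2)-set with a peak
   has a subset coloured by code 0 or 1, so this creates no monochromatic set. *)
Definition peak_color (r k c : nat) : nat :=
  if r == 3 then k
  else if odd r then k + c
  else if c == 2 then 0 else k + c.

Lemma peak_color_lt r k c : 0 < k -> c <= 2 -> peak_color r k c < k + eta r.
Proof.
rewrite /peak_color /eta; case: eqP => _; first by lia.
by case: (odd r) => /=; [lia | case: eqP; lia].
Qed.

Section SteppedColoring.
Variables (n r : nat) (s : seq nat).
Variable f : {set 'I_n} -> 'I_(size s).

Definition stepped_color (v : seq nat) : nat :=
  if has id (peaks v) then peak_color r (size s) (code (peaks v))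
  else f [set i : 'I_n | val i \in v].

Lemma stepped_color_old v : stepped_color v < size s ->
  has id (peaks v) -> ~~ odd r /\ code (peaks v) = 2.
Proof.
rewrite /stepped_color => h hv; move: h; rewrite hv /peak_color.
case: eqP => _; first by rewrite ltnn.
by case: ifP => _; [lia | case: eqP => [->|]; lia].
Qed.

Lemma stepped_color_new v v' : size v = r -> size v' = r ->
  size s <= stepped_color v -> stepped_color v = stepped_color v' ->
  has id (peaks v) /\ code (peaks v) = code (peaks v').
Proof.
move=> sv sv' h e; have n1 : has id (peaks v).
  by move: h; rewrite /stepped_color; case: ifP => // _; rewrite leqNgt ltn_ord.
have n2 : has id (peaks v').
  by move: h; rewrite e /stepped_color; case: ifP => // _; rewrite leqNgt ltn_ord.
split=> //; move: h e; rewrite /stepped_color n1 n2 /peak_color.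
(* For [r = 3] both flag words have length one and are [[:: true]]. *)
case: eqP => [r3 _ _|_].
  move: n1 n2 (size_peaks v) (size_peaks v'); rewrite sv sv' r3.
  by case: (peaks v) => [|[] []] //; case: (peaks v') => [|[] []].
have s0 := leq_ltn_trans (leq0n _) (ltn_ord (f set0)).
case: ifP => _; first by lia.
by case: eqP; case: eqP; lia.
Qed.

End SteppedColoring.

(** * The stepping-up argument *)

Theorem theorem1p1 (k n r : nat) (s : seq nat) :
  2 <= k -> 3 <= r -> r < n -> size s = k ->
  (forall i, i < k -> r.+1 <= nth 0 s i <= n) ->
  ~ arrows n s r ->
  ~ arrows (2 ^ n) (map S s ++ nseq (eta r) r.+2) r.+1.
Proof.
move=> k2 r3 rn sk sb nA A; apply: nA => f.
set s' := map S s ++ _ in A.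
have ss' : size s' = size s + eta r by rewrite size_cat size_map size_nseq.
have s0 : 0 < size s' by lia.
(* The default of [insubd] is never taken, as every colour is below [size s']. *)
pose F (Y : {set 'I_(2 ^ n)}) : 'I_(size s') :=
  insubd (Ordinal s0) (stepped_color n r s f (deltas (vals _ Y))).
have [i [X [cX mX]]] := A F.
have new_size j : size s <= j < size s + eta r -> nth 0 s' j = r.+2.
  move=> /andP[h1 h2]; rewrite nth_cat size_map ltnNge h1 nth_nseq ifT //=.
  by rewrite -(ltn_add2l (size s)) subnKC.
have cF v : realized (vals _ X) v -> size v = r -> stepped_color n r s f v = i.
  move=> H sv; have [Y [YX cY eY]] := realized_set _ _ _ _ H sv.
  rewrite -(mX Y YX cY) /F eY val_insubd ifT // ss' /stepped_color.
  case: ifP => _; first by apply: peak_color_lt; [lia|exact: code_le2].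
  by apply: ltn_addr.
have Xs := vals_sorted _ X.
pose u := deltas (vals _ X).
have [x [l eX]] : exists x l, vals _ X = x :: l.
  case E : (vals _ X) => [|x l]; last by exists x, l.
  move: cX; rewrite -size_vals E /=; case: (ltnP i (size s)) => h.
    by rewrite nth_cat size_map h (nth_map 0).
  by rewrite new_size // h -ss' ltn_ord.
have Hu : realized (vals _ X) u by exists x, l; rewrite /u eX.
have su : size u = (nth 0 s' i).-1.
  by rewrite -cX -size_vals /u eX /= size_pairmap.
case: (ltnP i (size s)) => [ik|ki]; last first.
  move: su; rewrite new_size /= => [su|]; last by rewrite ki -ss' ltn_ord.
  have new v v' : realized (vals _ X) v -> realized (vals _ X) v' ->
      size v = r -> size v' = r ->
      has id (peaks v) /\ code (peaks v) = code (peaks v').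
    by move=> H H' sv sv'; apply: (stepped_color_new n r s f); rewrite ?cF.
  (* In a new colour both windows of [u] have a peak, with equal codes: a contradiction. *)
  have [|v1 [v2 [b [[H1 s1] [H2 s2] _ _]]]] := same_code_no_peaks _ Xs _ _ r3 su Hu.
    by move=> v v' H H' sv sv' _ _; case: (new v v').
  by rewrite (proj1 (new v1 v2 _ _ _ _)) // (proj1 (new v2 v1 _ _ _ _)).
have /andP[si _] := sb _ (eq_ind _ (fun k => i < k) ik _ sk).
move: su; rewrite nth_cat size_map ik (nth_map 0) //= => su.
have old v : realized (vals _ X) v -> size v = r -> has id (peaks v) ->
    ~~ odd r /\ code (peaks v) = 2.
  by move=> H sv; apply: (stepped_color_old n r s f); rewrite cF.
have npu : ~~ has id (peaks u).
  (* The induction starts at length [r.+1], at most the length [s_i] of [u], because for even [r]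
     words of length [r] may have a peak with code 2. *)
  apply: (no_peaks_extend _ Xs r.+1) => // [||w Hw sw]; [exact: leqW|by rewrite su|].
  case: (boolP (odd r)) => ro.
    apply: (no_peaks_extend _ Xs r) => // [|v H sv]; first by rewrite sw.
    by apply/negP => /(old _ H sv)[]; rewrite ro.
  by apply: (even_no_peaks _ Xs r) => // v H sv /(old _ H sv)[].
have Vu := realized_valley _ Xs _ Hu npu.
have uu := valley_uniq _ Xs _ Hu Vu.
have un := realized_lt _ _ _ Hu.
(* The [s_i] deltas of [X] form the monochromatic set for [f]: any [r] of them form a realized word
   without peak, coloured by [f]. *)
exists (Ordinal ik), [set j | val j \in u]; split; first by rewrite card_mem_ord.
move=> T TD cT; pose v := [seq d <- u | d \in vals n T].
have vu : subseq v u by exact: filter_subseq.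
have eT : [set j : 'I_n | val j \in v] = T.
  apply/setP => j; rewrite inE mem_filter mem_vals.
  by case: (boolP (j \in T)) => // /(subsetP TD); rewrite inE.
have sv : size v = r.
  rewrite -cT -eT card_mem_ord //; first exact: filter_uniq.
  by rewrite all_filter; apply: sub_all un => d dn; apply/implyP.
have Hv : realized (vals _ X) v by apply: (valley_filter _ Xs _ [::]).
have := cF v Hv sv; rewrite /stepped_color (negbTE (valley_peaks _ (valley_sub _ _ vu Vu))).
by rewrite eT => e; exact: val_inj.
Qed.
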